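(* Let $L$ be the implicational propositional calculus, let $Q$ be a well-formed formula, and for a well-formed formula $A$ write $QA := A\supset Q$. Every extension $M$ of $L$ with $Q\notin\mathbb{T}(M)$ has an extension $N$ such that $Q \notin \mathbb{T}(N)$ and, for every well-formed formula $A$, either $QQA \in \mathbb{T}(N)$ or $QA \in \mathbb{T}(N)$.
   Context: The implicational propositional calculus $L$ has countably many propositional variables (so the well-formed formulas can be enumerated as $A_0, A_1, \dots$), $\supset$ as its only connective, modus ponens as its only inference rule, and the axiom schemes $A \supset (B \supset A)$, $[A \supset (B \supset C)] \supset [(A \supset B) \supset (A \supset C)]$, and $[(A \supset B) \supset A] \supset A$. An extension of a system is obtained by adding (possibly infinitely many) well-formed formulas as extra axioms (modus ponens remains the only rule); $\mathbb{T}(M)$ denotes the set of theorems of the system $M$. *)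

(* Defs.v *)
From Stdlib Require Import Ensembles.

Inductive form : Type :=
| Var : nat -> form
| Imp : form -> form -> form.

Declare Scope form_scope.
Delimit Scope form_scope with form.
Bind Scope form_scope with form.
Notation "A ⊃ B" := (Imp A B) (at level 60, right associativity) : form_scope.

(* Modus ponens is the only rule of every system considered (in particular there
   is no substitution rule), so a system is given by its set of axioms. *)
Definition system : Type := Ensemble form.

Inductive thm (M : system) : Ensemble form :=
| thm_ax : forall A : form, In form M A -> In form (thm M) A
| thm_mp : forall A B : form,
    In form (thm M) (A ⊃ B)%form -> In form (thm M) A -> In form (thm M) B.

Inductive L : system :=
| L_K : forall A B : form, In form L (A ⊃ (B ⊃ A))%form
| L_S : forall A B C : form,
    In form L ((A ⊃ (B ⊃ C)) ⊃ ((A ⊃ B) ⊃ (A ⊃ C)))%form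
| L_Peirce : forall A B : form, In form L (((A ⊃ B) ⊃ A) ⊃ A)%form.

(* The set X of added axioms is arbitrary: possibly empty or infinite, and not
   required to be closed under substitution. *)
Definition extension (M N : system) : Prop :=
  exists X : Ensemble form, Same_set form N (Union form M X).

Definition imp_to (Q A : form) : form := (A ⊃ Q)%form.

(* Main.v *)
(** A Lindenbaum construction. Run through the formulas in the order of an
    injective code and add each formula whose addition does not yield [Q]; let
    [N] be the union of the stages. Derivations are finite, so [N] does not
    prove [Q]. A formula [A] that was added gives [(A ⊃ Q) ⊃ Q]; for one that was
    refused, the deduction theorem gives [A ⊃ Q] at the stage of refusal. *)

Require Import Defs.
From Stdlib Require Import Ensembles.
From Stdlib Require Import Classical Cantor Lia.

Lemma thm_mono (M N : system) :
  Included form M N -> Included form (thm M) (thm N).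
Proof.
  intros HMN A HA. induction HA as [A HA | A B _ IHAB _ IHA].
  - apply thm_ax, HMN, HA.
  - exact (thm_mp N A B IHAB IHA).
Qed.

Lemma thm_weaken (M : system) (A B : form) :
  Included form L M -> In form (thm M) B -> In form (thm M) (A ⊃ B)%form.
Proof.
  intros HL HB. apply thm_mp with B; [apply thm_ax, HL, L_K | exact HB].
Qed.

Lemma thm_distr (M : system) (A B C : form) :
  Included form L M -> In form (thm M) (A ⊃ B ⊃ C)%form ->
  In form (thm M) (A ⊃ B)%form -> In form (thm M) (A ⊃ C)%form.
Proof.
  intros HL HABC HAB. apply thm_mp with (A ⊃ B)%form; [| exact HAB].
  apply thm_mp with (A ⊃ B ⊃ C)%form; [apply thm_ax, HL, L_S | exact HABC].
Qed.

(** The combinator derivation S K K: both premises of [thm_distr] are instances of K. *)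
Lemma thm_id (M : system) (A : form) :
  Included form L M -> In form (thm M) (A ⊃ A)%form.
Proof.
  intros HL. apply thm_distr with (A ⊃ A)%form; [exact HL | |];
    apply thm_ax, HL, L_K.
Qed.

(** Induction on the derivation: K handles an old axiom, [thm_id] the added one, and S carries a
    modus ponens under the premise [A]. *)
Lemma deduction (M : system) (A B : form) :
  Included form L M -> In form (thm (Add form M A)) B ->
  In form (thm M) (A ⊃ B)%form.
Proof.
  intros HL HB. induction HB as [B HB | B C _ IHBC _ IHB].
  - destruct HB as [B HB | B HB].
    + apply thm_weaken; [exact HL | apply thm_ax, HB].
    + destruct HB. apply thm_id, HL.
  - exact (thm_distr M A B C HL IHBC IHB).
Qed.

(** Under the premise [A ⊃ Q], both [A ⊃ Q] and [A] are available, and S combines them. *)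
Lemma thm_double_imp (M : system) (Q A : form) :
  Included form L M -> In form (thm M) A ->
  In form (thm M) (imp_to Q (imp_to Q A)).
Proof.
  intros HL HA. apply thm_distr with A.
  - exact HL.
  - apply thm_id, HL.
  - apply thm_weaken; assumption.
Qed.

(** Parity separates variables from implications; Cantor pairing keeps the two subformulas
    recoverable. *)
Fixpoint code (A : form) : nat :=
  match A with
  | Var n => 2 * n
  | Imp B C => 2 * to_nat (code B, code C) + 1
  end.

Lemma code_inj (A B : form) : code A = code B -> A = B.
Proof.
  revert B. induction A as [n | A1 IH1 A2 IH2]; intros [m | B1 B2];
    cbn [code]; intros H; try lia.
  - f_equal. lia.
  - assert (E : (code A1, code A2) = (code B1, code B2)).
    { apply to_nat_inj. lia. }
    injection E as E1 E2. f_equal; auto.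
Qed.

(** Being a predicate, a stage requires neither a decoding function nor a decision procedure for
    provability; a number that codes no formula adds nothing. *)
Fixpoint stage (Q : form) (M : system) (n : nat) : system :=
  match n with
  | 0 => M
  | S n => fun A => In form (stage Q M n) A \/
      (code A = n /\ ~ In form (thm (Add form (stage Q M n) A)) Q)
  end.

Definition limit (Q : form) (M : system) : system :=
  fun A => exists n, In form (stage Q M n) A.

Lemma stage_mono (Q : form) (M : system) (n m : nat) :
  n <= m -> Included form (stage Q M n) (stage Q M m).
Proof.
  intros Hnm. induction Hnm as [| m _ IH]; intros A HA.
  - exact HA.
  - left. exact (IH A HA).
Qed.

(** Since [code] is injective, a step admits at most one formula. The new stage thus lies inside the
    very system whose failure to prove [Q] was the condition of admission, or inside the previous
    stage. *)
Lemma stage_unprovable (Q : form) (M : system) (n : nat) :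
  ~ In form (thm M) Q -> ~ In form (thm (stage Q M n)) Q.
Proof.
  intros HQ. induction n as [| n IH]; [exact HQ |].
  destruct (classic (exists A, code A = n /\
      ~ In form (thm (Add form (stage Q M n) A)) Q)) as [[A [HA HAQ]] | Hno];
    intros HSQ.
  - apply HAQ. revert HSQ. apply thm_mono. intros B [HB | [HB _]].
    + left. exact HB.
    + right. rewrite (code_inj B A) by congruence. constructor.
  - apply IH. revert HSQ. apply thm_mono. intros B [HB | HB].
    + exact HB.
    + exfalso. eauto.
Qed.

(** Stages increase, so the two premises of a modus ponens, found at stages [n] and [m], are both
    theorems of stage [n + m]. *)
Lemma thm_limit (Q : form) (M : system) (A : form) :
  In form (thm (limit Q M)) A -> exists n, In form (thm (stage Q M n)) A.
Proof.
  intros HA. induction HA as [A [n Hn] | A B _ [n Hn] _ [m Hm]].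
  - exists n. apply thm_ax, Hn.
  - exists (n + m). apply thm_mp with A.
    + revert Hn. apply thm_mono, stage_mono. lia.
    + revert Hm. apply thm_mono, stage_mono. lia.
Qed.

Lemma stage_limit (Q : form) (M : system) (n : nat) :
  Included form (stage Q M n) (limit Q M).
Proof. intros A HA. exists n. exact HA. Qed.

Lemma limit_decides (Q : form) (M : system) (A : form) :
  Included form L M ->
  In form (thm (limit Q M)) (imp_to Q (imp_to Q A)) \/
  In form (thm (limit Q M)) (imp_to Q A).
Proof.
  intros HL.
  destruct (classic (In form (thm (Add form (stage Q M (code A)) A)) Q))
    as [HAQ | HAQ].
  - right. apply (thm_mono _ _ (stage_limit Q M (code A))).
    apply deduction; [| exact HAQ].
    intros B HB. apply (stage_mono Q M 0); [lia | exact (HL B HB)].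
  - left. apply thm_double_imp.
    + intros B HB. exact (stage_limit Q M 0 B (HL B HB)).
    (* [A] is tested against stage [code A], so it enters one stage later. *)
    + apply thm_ax. exists (S (code A)). right. auto.
Qed.

Lemma extension_included (M N : system) :
  extension M N <-> Included form M N.
Proof.
  split.
  - intros [X [_ HX]] A HA. apply HX. left. exact HA.
  (* All of [N] can serve as the added axioms, since the union of [M] and [N] is then [N]. *)
  - intros HMN. exists N. split; intros A HA.
    + right. exact HA.
    + destruct HA as [A HA | A HA]; [exact (HMN A HA) | exact HA].
Qed.

Theorem theorem4 (Q : form) (M : system) :
  extension L M ->
  ~ In form (thm M) Q ->
  exists N : system,
    extension M N /\
    ~ In form (thm N) Q /\
    forall A : form,
      In form (thm N) (imp_to Q (imp_to Q A)) \/ In form (thm N) (imp_to Q A).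
Proof.
  intros HL HQ. rewrite extension_included in HL.
  exists (limit Q M). repeat split.
  - apply extension_included, (stage_limit Q M 0).
  - intros HNQ. destruct (thm_limit Q M Q HNQ) as [n Hn].
    exact (stage_unprovable Q M n HQ Hn).
  - intros A. apply limit_decides, HL.
Qed.
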